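(* Let $L_i:\mathbb{R}^{n_{i-1}}\to\mathbb{R}^{n_i}$, $i=1,\ldots,N$, be affine linear functions with $n_0=n$, let $s_i$ ($i=1,\ldots,N-1$) be the entrywise step functions on $\mathbb{R}^{n_i}$, and let $\sigma:\mathbb{R}^{n_N}\to\{1,\ldots,n_N\}$ be the index-max function. Let $D\subset\mathbb{R}^n$ be any subset, and assume that for $i=2,\ldots,N$ the hyperplanes defined by $L_i$ (the zero loci of its components) do not contain the set $(s_{i-1}\circ L_{i-1}\circ\cdots\circ s_1\circ L_1)(D)$. Then the function \[\sigma \circ L_{N} \circ s_{N-1} \circ L_{N-1} \circ \cdots \circ s_1 \circ L_1\] (a feed-forward network with step activation functions at the hidden layers and index-max at the last layer), restricted to $D$, is a linear logical function $D\to T$ with target $T=\{1,\ldots,n_N\}$.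
   Context: The step function takes the value $0$ on negative numbers and $1$ on nonnegative numbers. The index-max function $\sigma$ sends a vector to the index of its maximal entry (with a fixed tie-breaking convention, e.g. the smallest such index). Linear logical functions. For an affine linear function $l=(l_1,\ldots,l_k)$ on $\mathbb{R}^n$, the chambers of $l$ are the regions into which $\mathbb{R}^n$ is subdivided by the hyperplanes $\{l_i=0\}$; they are defined to contain some of their boundary strata in such a way that they are disjoint and their union is $\mathbb{R}^n$ (concretely: the nonempty sets obtained by imposing, for each $i$, either $l_i\ge 0$ or $l_i<0$). Let $D\subset\mathbb{R}^n$ and let $T$ be a finite set. A linear logical graph $(G,L)$ consists of a finite directed graph $G$ (parallel arrows allowed) with no oriented cycle, with exactly one source vertex (vertex with no incoming arrow) and exactly $|T|$ target vertices (vertices with no outgoing arrow), identified with the elements of $T$, together with a collection $L=\{l_v\}$ of affine linear functions on $\mathbb{R}^n$, one for each vertex $v$ having more than one outgoing arrow, such that the chambers of $l_v$ are in one-to-one correspondence with the outgoing arrows of $v$. It determines a function $f_{G,L}: D\to T$: given $x\in D$, start at the source vertex; at a vertex with exactly one outgoing arrow follow that arrow; at a vertex $v$ with more than one outgoing arrow follow the arrow corresponding to the chamber of $l_v$ containing $x$; this stops at a target vertex, and $f_{G,L}(x)\in T$ is the element associated to it. A function $D\to T$ is a linear logical function if it equals $f_{G,L}$ for some linear logical graph $(G,L)$. *)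

(* Defs.v *)
From mathcomp Require Import all_boot all_order all_algebra.
From mathcomp Require Import boolp classical_sets functions reals.
Set Implicit Arguments.
Unset Strict Implicit.
Unset Printing Implicit Defensive.
Import Order.TTheory GRing.Theory Num.Theory.
Local Open Scope classical_set_scope.
Local Open Scope ring_scope.

(* Vectors of R^n are row vectors 'rV[R]_n; an affine map is x |-> x A + b. *)
Record affmap (R : realType) (m k : nat) := AffMap {
  aff_mx : 'M[R]_(m, k);
  aff_cst : 'rV[R]_k }.

Definition affmap_fun (R : realType) (m k : nat) (l : affmap R m k) :
  'rV[R]_m -> 'rV[R]_k := fun x => x *m aff_mx l + aff_cst l.
Coercion affmap_fun : affmap >-> Funclass.

Definition zero_locus (R : realType) (m k : nat) (l : affmap R m k)
  (j : 'I_k) : set 'rV[R]_m := [set x | l x 0 j = 0].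

Definition chamber_of_signs (R : realType) (m k : nat) (l : affmap R m k)
  (eps : 'I_k -> bool) : set 'rV[R]_m :=
  [set x | forall i, if eps i then 0 <= l x 0 i else l x 0 i < 0].

Definition chambers (R : realType) (m k : nat) (l : affmap R m k) :
  set (set 'rV[R]_m) :=
  [set C | C !=set0 /\ exists eps : 'I_k -> bool, C = chamber_of_signs l eps].

(* [llg_cham a] is the chamber attached to the arrow [a]; it and
   [llg_l (llg_src a)] are junk when [a] is the only arrow leaving its
   source.  [llg_label] identifies T with the set of target vertices, and
   [cycle e c] with c nonempty is an oriented closed walk, loops included. *)
Record linear_logical_graph (R : realType) (n : nat) (T : finType) := LLGraph {
  llg_vertex : finType;
  llg_arrow : finType;
  llg_src : llg_arrow -> llg_vertex;
  llg_tgt : llg_arrow -> llg_vertex;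
  llg_root : llg_vertex;
  llg_label : T -> llg_vertex;
  llg_k : llg_vertex -> nat;
  llg_l : forall v, affmap R n (llg_k v);
  llg_cham : llg_arrow -> set 'rV[R]_n;
  llg_acyclic : forall c : seq llg_vertex,
    cycle [rel u v | [exists a, (llg_src a == u) && (llg_tgt a == v)]] c ->
    c = [::];
  llg_rootP : forall v, (forall a, llg_tgt a <> v) <-> v = llg_root;
  llg_label_inj : injective llg_label;
  llg_labelP : forall v,
    (forall a, llg_src a <> v) <-> exists t, llg_label t = v;
  llg_chamP : forall v, (1 < #|[pred a | llg_src a == v]|)%N ->
    set_bij [set a | llg_src a = v] (chambers (llg_l v)) llg_cham }.

Section Evaluation.
Variables (R : realType) (n : nat) (T : finType).
Variable G : linear_logical_graph R n T.
Implicit Types (x : 'rV[R]_n) (u v w : llg_vertex G) (a b : llg_arrow G).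

Definition llg_follows x a :=
  (1 < #|[pred b | llg_src b == llg_src a]|)%N -> llg_cham a x.

(* [llg_run x v w]: following the arrows prescribed by [x] from [v], one stops
   at [w]. *)
Inductive llg_run x : llg_vertex G -> llg_vertex G -> Prop :=
| llg_stop v : (forall a, llg_src a <> v) -> llg_run x v v
| llg_move a w : llg_follows x a -> llg_run x (llg_tgt a) w ->
    llg_run x (llg_src a) w.

Lemma llg_path_uniq v (p : seq (llg_vertex G)) :
  path [rel u v | [exists a, (llg_src a == u) && (llg_tgt a == v)]] v p ->
  uniq (v :: p).
Proof.
elim: p v => [|w p IHp] v //= /andP[evw pwp].
have := IHp w pwp; rewrite /= => ->; rewrite andbT; apply/negP => vp.
have : path [rel u v | [exists a, (llg_src a == u) && (llg_tgt a == v)]]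
  v (w :: p) by rewrite /= evw pwp.
case/splitPr: vp => p1 p2; rewrite -cat_rcons cat_path => /andP[cyc _].
by have := llg_acyclic (c := v :: p1) cyc.
Qed.

Lemma llg_mem_chamber x v : exists2 C, chambers (llg_l v) C & C x.
Proof.
have xC : chamber_of_signs (llg_l v) (fun i => 0 <= llg_l v x 0 i) x.
  by move=> i; case: ifPn => //; rewrite -ltNge.
by exists (chamber_of_signs (llg_l v) (fun i => 0 <= llg_l v x 0 i)) => //; split;
  [exists x | exists (fun i => 0 <= llg_l v x 0 i)].
Qed.

Lemma llg_chamber_unique x v (C C' : set 'rV[R]_n) :
  chambers (llg_l v) C -> chambers (llg_l v) C' -> C x -> C' x -> C = C'.
Proof.
move=> [_ [e ->]] [_ [e' ->]] ex e'x; congr chamber_of_signs.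
apply/funext => i; move: (ex i) (e'x i).
by case: (e i); case: (e' i) => // h1 h2; move: (le_lt_trans h1 h2) ||
  move: (le_lt_trans h2 h1); rewrite ltxx.
Qed.

Lemma llg_follows_exists x v :
  ~ (forall a, llg_src a <> v) -> exists2 a, llg_src a = v & llg_follows x a.
Proof.
move=> /existsNP[a /contrapT av].
have [out|out] := ltnP 1 #|[pred b | llg_src b == v]|.
  have [C CV Cx] := llg_mem_chamber x v.
  have [_ _ surj] := llg_chamP out.
  have [b /= bv bC] := surj C CV.
  by exists b => // _; rewrite bC.
by exists a => //; rewrite /llg_follows av ltnNge out.
Qed.

Lemma llg_follows_unique x a b :
  llg_src a = llg_src b -> llg_follows x a -> llg_follows x b -> a = b.
Proof.
rewrite /llg_follows => ab; rewrite ab.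
have [out|out] := ltnP 1 #|[pred c | llg_src c == llg_src b]|.
  move=> /(_ isT) ax /(_ isT) bx.
  have [mem inj _] := llg_chamP out.
  apply: inj; rewrite ?inE //=.
  by apply: (llg_chamber_unique (x := x) (v := llg_src b)) => //; apply: mem.
by move=> _ _; apply: (card_le1_eqP out); rewrite inE ?ab.
Qed.

Lemma llg_run_total x : exists t, llg_run x (llg_root G) (llg_label G t).
Proof.
suff H k (p : seq (llg_vertex G)) :
    path [rel u v | [exists a, (llg_src a == u) && (llg_tgt a == v)]]
      (llg_root G) p -> (#|llg_vertex G| <= size p + k)%N ->
    exists t, llg_run x (last (llg_root G) p) (llg_label G t).
  exact: (H #|llg_vertex G| [::]).
elim: k p => [|k IHk] p pp.
  rewrite addn0 => szp; have /card_uniqP /= := llg_path_uniq pp.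
  move=> cp; have := max_card (mem (llg_root G :: p)).
  by rewrite cp ltnNge szp.
move=> szp; set v := last _ p.
have [vt|/(llg_follows_exists x)[a av xa]] := pselect (forall a, llg_src a <> v).
  by have [t tv] := (llg_labelP v).1 vt; exists t; rewrite tv; apply: llg_stop.
have [||t] := IHk (rcons p (llg_tgt a)).
- by rewrite rcons_path pp /=; apply/existsP; exists a; rewrite av !eqxx.
- by rewrite size_rcons addSnnS.
by rewrite last_rcons => run; exists t; rewrite -av; apply: llg_move run.
Qed.

(* The function f_{G,L}. *)
Definition llg_fun x : T := projT1 (cid (llg_run_total x)).

Lemma llg_run_unique x v w w' : llg_run x v w -> llg_run x v w' -> w = w'.
Proof.
move=> vw; elim: vw w' => {v w} [v vt w'|a w xa _ IH w'] run.
  by case: run vt => // b w1 _ _ /(_ b).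
move ev: (llg_src a) run => v run; case: run ev => [u ut /ut //|b w1 xb run ab].
by apply: IH; rewrite (llg_follows_unique ab xa xb).
Qed.

Lemma llg_funP x t :
  llg_run x (llg_root G) (llg_label G t) <-> llg_fun x = t.
Proof.
rewrite /llg_fun; case: cid => t' /= run; split => [run'|<- //].
by apply: (@llg_label_inj _ _ _ G); apply: llg_run_unique run run'.
Qed.

End Evaluation.

Definition linear_logical_function (R : realType) (n : nat) (T : finType)
  (D : set 'rV[R]_n) (f : 'rV[R]_n -> T) : Prop :=
  exists G : linear_logical_graph R n T, forall x, D x -> f x = llg_fun G x.

Definition step (R : realType) (k : nat) : 'rV[R]_k -> 'rV[R]_k :=
  map_mx (fun t => if 0 <= t then 1 else 0).

(* A tie-breaking convention picks one of the maximal indices as a function of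
   the set of all of them, e.g. the smallest one. *)
Definition tie_breaking (k : nat) (tie : {set 'I_k} -> 'I_k) : Prop :=
  forall A : {set 'I_k}, A != finset.set0 -> tie A \in A.

Definition index_max (R : realType) (k : nat) (tie : {set 'I_k} -> 'I_k)
  (y : 'rV[R]_k) : 'I_k :=
  tie [set i | [forall j, y 0 j <= y 0 i]]%SET.

(* hidden L i = s_i \o L_i \o ... \o s_1 \o L_1, where [L i] stands for L_{i+1}
   since families are indexed from 0. *)
Fixpoint hidden (R : realType) (n : nat -> nat)
  (L : forall i, affmap R (n i) (n i.+1)) (i : nat) :
  'rV[R]_(n 0%N) -> 'rV[R]_(n i) :=
  match i with
  | 0%N => id
  | i'.+1 => @step R (n i'.+1) \o L i' \o hidden L i'
  end.

(* Main.v *)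
Require Import Defs.
From mathcomp Require Import all_boot all_order all_algebra.
From mathcomp Require Import boolp classical_sets functions reals.
Import Order.TTheory GRing.Theory Num.Theory.
Local Open Scope classical_set_scope.
Local Open Scope ring_scope.

(** The network only looks at the signs of finitely many affine forms of its
    input: when there is a hidden layer, everything factors through the step
    function applied to the first affine map; when there is none, the index of
    the maximal entry is read off the signs of the pairwise differences of the
    entries.  So it suffices to show that every function of the signs of
    finitely many affine forms is linear logical
    ([linear_logical_of_sign_invariant]).

    A graph with a root and one arrow per chamber into the targets would
    compute such a function [f], but a linear logical graph must have all of T
    as target vertices and only one source, so that a value which [f] never
    takes still needs an incoming arrow.  The graph therefore asks the same
    question twice: the root sends chamber [e] to a vertex [e], and vertex [e]
    asks for the chamber once more.  The answer is again [e], and leads to the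
    value of [f] on [e]; the arrows of vertex [e] for the other chambers are
    never followed and can be used to reach every element of T
    ([linear_logical_of_many_chambers]).  This needs at least two chambers, and
    as many as there are targets; since the input space has positive dimension,
    adding enough parallel hyperplanes to the arrangement provides them. *)

Section SignPatterns.
Context {R : realType} {n k : nat}.
Variable l : affmap R n k.

Definition sign_pattern (x : 'rV[R]_n) : {ffun 'I_k -> bool} :=
  [ffun i => 0 <= l x 0 i].

Lemma chamber_of_signsP (e : {ffun 'I_k -> bool}) x :
  chamber_of_signs l e x <-> sign_pattern x = e.
Proof.
split=> [xe|<- i]; last by rewrite ffunE; case: ifPn => //; rewrite -ltNge.
apply/ffunP => i; rewrite ffunE; move: (xe i).
by case: (e i) => //; rewrite ltNge => /negbTE.
Qed.

(** The chambers of [l] as a finite type, each one being encoded by its signs: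
    different sign vectors give disjoint sets. *)
Definition chamber_index : finType :=
  {e : {ffun 'I_k -> bool} | `[< exists x, sign_pattern x = e >]}.

Definition chamber_index_of (x : 'rV[R]_n) : chamber_index :=
  exist _ (sign_pattern x) (asboolT (ex_intro _ x erefl)).

Lemma chamber_index_point (e : chamber_index) :
  {x | sign_pattern x = val e}.
Proof. by apply: cid; apply/asboolP; exact: (valP e). Qed.

Lemma chamber_index_bij :
  set_bij [set: chamber_index] (chambers l)
    (fun e => chamber_of_signs l (val e)).
Proof.
split=> [e _|e e' _ _ ee'|C [[x xC] [e eC]]].
- by split; [have [x xe] := chamber_index_point e; exists x;
    apply/chamber_of_signsP | exists (val e)].
- have [x xe] := chamber_index_point e; apply: val_inj.
  by rewrite -xe; apply/chamber_of_signsP; rewrite -ee'; apply/chamber_of_signsP.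
- have eE : e = finfun e by apply/funext => i; rewrite ffunE.
  exists (chamber_index_of x) => //=; rewrite eC eE in xC *.
  by rewrite (chamber_of_signsP (finfun e) x).1.
Qed.

End SignPatterns.

Section TwoLevelGraph.
Context {R : realType} {n k : nat} {T : finType}.
Variables (l : affmap R n k).
Let E := chamber_index l.
Variables (value dead : E -> T).
Hypothesis chambers_gt1 : (1 < #|E|)%N.
Hypothesis dead_surj : forall t, exists e, dead e = t.

(** [inl None] is the root and [inl (Some e)] is reached by the points of the
    chamber [e]. *)
Let vertex : finType := (option E + T)%type.
Let arrow : finType := (option E * E)%type.
Let src (a : arrow) : vertex := inl a.1.
Let tgt (a : arrow) : vertex :=
  if a.1 is Some e then inr (if a.2 == e then value e else dead a.2)
  else inl (Some a.2).
Let cham (a : arrow) : set 'rV[R]_n := chamber_of_signs l (val a.2).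

Lemma two_level_acyclic (c : seq vertex) :
  cycle [rel u v | [exists a, (src a == u) && (tgt a == v)]] c -> c = [::].
Proof.
pose depth (v : vertex) : nat :=
  match v with inl None => 0 | inl (Some _) => 1 | inr _ => 2 end.
case: c => // v p /= cyc.
have : path (relpre depth ltn) v (rcons p v).
  apply: sub_path cyc => u w /= /existsP[[[e|] e'] /andP[/eqP <- /eqP <-]] //.
rewrite path_sortedE; last by move=> a b c /=; exact: ltn_trans.
by rewrite all_rcons /= ltnn.
Qed.

Lemma two_level_rootP v : (forall a, tgt a <> v) <-> v = inl None.
Proof.
split=> [noin|-> [[e|] e'] //].
case: v noin => [[e|]|t] // noin; first by case: (noin (None, e)).
have [e et] := dead_surj t.
(* the arrow labelled [e] is a dead one provided it leaves another vertex *)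
have [e' ee'] : exists e', e' != e.
  move/card_gt1P: chambers_gt1 => [e1 [e2 [_ _ e12]]].
  have [e1e|] := eqVneq e1 e; last by exists e1.
  by exists e2; rewrite -e1e eq_sym.
by case: (noin (Some e', e)); rewrite /tgt /= eq_sym (negbTE ee') et.
Qed.

Lemma two_level_labelP v :
  (forall a, src a <> v) <-> exists t, inr t = v :> vertex.
Proof.
split=> [noout|[t <-] //]; case: v noout => [u|t] noout; last by exists t.
have /card_gt0P[e _] : (0 < #|E|)%N by exact: ltnW.
by case: (noout (u, e)).
Qed.

Lemma two_level_chamP v : (1 < #|[pred a | src a == v]|)%N ->
  set_bij [set a | src a = v] (chambers l) cham.
Proof.
case: v => [u _|t]; last by rewrite eq_card0.
have [mem inj surj] := chamber_index_bij l.
split=> [[u' e] _|[u1 e1] [u2 e2]|C /surj[e _ <-]]; first exact: mem.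
  rewrite !inE /src /cham /= => -[->] [->] /inj -> //; rewrite inE //.
by exists (u, e).
Qed.

Lemma inr_vertex_inj : injective (inr : T -> vertex).
Proof. by move=> t t' []. Qed.

Definition two_level_graph : linear_logical_graph R n T :=
  @LLGraph R n T vertex arrow src tgt (inl None) inr (fun=> k) (fun=> l) cham
    two_level_acyclic two_level_rootP inr_vertex_inj two_level_labelP
    two_level_chamP.

Lemma two_level_graphE x :
  llg_fun two_level_graph x = value (chamber_index_of l x).
Proof.
set e := chamber_index_of l x.
have xe u : @llg_follows _ _ _ two_level_graph x (u, e).
  by move=> _; apply/chamber_of_signsP.
apply/llg_funP; apply: (llg_move (xe None)) => /=.
apply: (llg_move (xe (Some e))) => /=.
by rewrite /tgt /= eqxx; apply: llg_stop.
Qed.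

End TwoLevelGraph.

Lemma linear_logical_of_many_chambers {R : realType} {n k : nat} {T : finType}
    (l : affmap R n k) (D : set 'rV[R]_n) (f : 'rV[R]_n -> T) :
    (1 < #|chamber_index l|)%N -> (#|T| <= #|chamber_index l|)%N ->
    (forall x y, sign_pattern l x = sign_pattern l y -> f x = f y) ->
  linear_logical_function D f.
Proof.
move=> gt1 leT fP.
pose value e := f (projT1 (chamber_index_point l e)).
pose h (t : T) : chamber_index l := enum_val (widen_ord leT (enum_rank t)).
have h_inj : injective h.
  move=> t t' /enum_val_inj /(congr1 val) /= tt'.
  by apply: enum_rank_inj; apply: val_inj.
pose dead e := odflt (f 0) [pick t | h t == e].
have dead_surj t : exists e, dead e = t.
  exists (h t); rewrite /dead; case: pickP => [t' /eqP/h_inj //|/(_ t)].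
  by rewrite eqxx.
exists (two_level_graph l value dead gt1 dead_surj) => x _.
rewrite two_level_graphE /value; case: chamber_index_point => y /= xy.
exact: fP.
Qed.

Definition affmap_of_forms {R : realType} {n : nat} {J : finType}
    (a : J -> affmap R n 1) : affmap R n #|J| :=
  AffMap (\matrix_(i, q) aff_mx (a (enum_val q)) i 0)
         (\row_q aff_cst (a (enum_val q)) 0 0).

Lemma affmap_of_formsE {R : realType} {n : nat} {J : finType}
    (a : J -> affmap R n 1) x j :
  affmap_of_forms a x 0 (enum_rank j) = a j x 0 0.
Proof.
rewrite /affmap_fun !mxE enum_rankK; congr (_ + _).
by apply: eq_bigr => i _; rewrite mxE enum_rankK.
Qed.

(** The forms [x_0 - j], for [j = 0, ..., #|T|], are added to the given ones.
    They separate the points with [x_0 = 0], ..., [x_0 = #|T|], so that the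
    refined arrangement has at least [#|T| + 1 >= 2] chambers, while [f] is
    still determined by the signs. *)
Lemma linear_logical_of_sign_invariant {R : realType} {n : nat} {J T : finType}
    (a : J -> affmap R n 1) (D : set 'rV[R]_n) (f : 'rV[R]_n -> T) :
    (0 < n)%N ->
    (forall x y, (forall j, (0 <= a j x 0 0) = (0 <= a j y 0 0)) -> f x = f y) ->
  linear_logical_function D f.
Proof.
move=> n_gt0 fP; pose i0 := Ordinal n_gt0.
pose parallel (j : 'I_#|T|.+1) : affmap R n 1 :=
  AffMap (delta_mx i0 0) (const_mx (- j%:R)).
have parallelE j x : parallel j x 0 0 = x 0 i0 - j%:R.
  rewrite /affmap_fun !mxE (bigD1 i0) //= big1 ?mxE ?eqxx ?mulr1 ?addr0 //.
  by move=> i /negbTE ii0; rewrite mxE ii0 mulr0.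
pose b (q : J + 'I_#|T|.+1) :=
  match q with inl j => a j | inr j => parallel j end.
pose l := affmap_of_forms b.
have patE x y : sign_pattern l x = sign_pattern l y ->
    forall q, (0 <= b q x 0 0) = (0 <= b q y 0 0).
  by move=> /ffunP xy q; move: (xy (enum_rank q)); rewrite !ffunE !affmap_of_formsE.
pose pt (j : 'I_#|T|.+1) : 'rV[R]_n := const_mx j%:R.
have leE : (#|T|.+1 <= #|chamber_index l|)%N.
  rewrite -[X in (X <= _)%N]card_ord.
  apply: (leq_card (fun j => chamber_index_of l (pt j))) => j j'.
  move=> /(congr1 val) /patE jj'; apply: val_inj; apply/eqP.
  have := jj' (inr j); have := jj' (inr j').
  rewrite /b !parallelE !mxE !subr_ge0 !ler_nat !leqnn eqn_leq.
  by move=> -> <-.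
have T_gt0 : (0 < #|T|)%N by apply/card_gt0P; exists (f 0).
apply: (linear_logical_of_many_chambers l) => [||x y xy].
- exact: leq_trans leE.
- exact: ltnW.
- by apply: fP => j; apply: (patE _ _ xy (inl j)).
Qed.

Definition affmap_form {R : realType} {m k : nat} (l : affmap R m k)
    (j : 'I_k) : affmap R m 1 :=
  AffMap (col j (aff_mx l)) (col j (aff_cst l)).

Lemma affmap_formE {R : realType} {m k : nat} (l : affmap R m k) j x :
  affmap_form l j x 0 0 = l x 0 j.
Proof.
by rewrite /affmap_fun !mxE; congr (_ + _); apply: eq_bigr => i _; rewrite mxE.
Qed.

(** The sign of the form indexed by [(i, j)] compares the entries [i] and [j] of
    [l x]; all these comparisons together determine the maximal entries. *)
Definition affmap_diff {R : realType} {m k : nat} (l : affmap R m k)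
    (p : 'I_k * 'I_k) : affmap R m 1 :=
  AffMap (col p.1 (aff_mx l) - col p.2 (aff_mx l))
         (col p.1 (aff_cst l) - col p.2 (aff_cst l)).

Lemma affmap_diffE {R : realType} {m k : nat} (l : affmap R m k) p x :
  affmap_diff l p x 0 0 = l x 0 p.1 - l x 0 p.2.
Proof.
rewrite -(affmap_formE l p.1) -(affmap_formE l p.2) /affmap_fun /= mulmxBr !mxE.
by rewrite opprD addrACA.
Qed.

Lemma eq_index_max {R : realType} {k : nat} (tie : {set 'I_k} -> 'I_k)
    (y z : 'rV[R]_k) :
    (forall i j, (y 0 j <= y 0 i) = (z 0 j <= z 0 i)) ->
  index_max tie y = index_max tie z.
Proof.
move=> yz; rewrite /index_max; congr tie; apply/setP => i; rewrite !inE.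
by apply: eq_forallb => j.
Qed.

Lemma hidden_factor {R : realType} {n : nat -> nat}
    (L : forall i, affmap R (n i) (n i.+1)) i x y :
  step (L 0%N x) = step (L 0%N y) -> hidden L i.+1 x = hidden L i.+1 y.
Proof. by move=> xy; elim: i => [//|i IH]; rewrite /= in IH *; rewrite IH. Qed.

(* The network has N = M.+1 >= 1 layers, L i being the affine map L_{i+1};
   only the maps L 0, ..., L M occur. *)
Theorem proposition2p2 (R : realType) (M : nat) (n : nat -> nat)
  (n0_gt0 : (0 < n 0%N)%N)
  (L : forall i : nat, affmap R (n i) (n i.+1))
  (tie : {set 'I_(n M.+1)} -> 'I_(n M.+1)) (tieP : tie_breaking tie)
  (D : set 'rV[R]_(n 0%N))
  (hL : forall i : nat, (0 < i <= M)%N -> forall j : 'I_(n i.+1),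
    ~ (hidden L i @` D `<=` zero_locus (L i) j)) :
  linear_logical_function D (index_max tie \o L M \o hidden L M).
Proof.
case: M tie tieP hL => [|M] tie _ _.
  apply: (linear_logical_of_sign_invariant (affmap_diff (L 0%N))) => // x y xy.
  apply: eq_index_max => i j.
  by have := xy (i, j); rewrite !affmap_diffE !subr_ge0.
apply: (linear_logical_of_sign_invariant (affmap_form (L 0%N))) => // x y xy.
congr (index_max tie (L M.+1 _)); apply: hidden_factor.
by apply/rowP => j; rewrite ![step _ _ _]mxE -(affmap_formE _ j x) xy affmap_formE.
Qed.
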